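(* Any Hausdorff space $X$ has cardinality $$|X|\le 2^{\chi_{\mathsf p^*}(X)\cdot aL_c(X)}\le 2^{\chi_{\mathsf p^*}(X)\cdot L(X)}\le 2^{\chi(X)\cdot L(X)}.$$ If the space $X$ is regular, then $$|X|\le 2^{\chi_{\mathsf p^*}(X)\cdot wL_c(X)}\le 2^{\chi_{\mathsf p^*}(X)\cdot c(X)}\le 2^{\chi(X)\cdot c(X)}.$$
   Context: An entourage on $X$ is a subset $E\subset X\times X$ containing the diagonal; $E[x]=\{y:(x,y)\in E\}$. An entourage base for $X$ is a family $\mathcal B$ of entourages such that (i) for all $B_1,B_2\in\mathcal B$ there is $B_3\in\mathcal B$ with $B_3\subset B_1\cap B_2$; (ii) for every $x\in X$ the family $\{B[x]:B\in\mathcal B\}$ is a neighborhood base at $x$. A set $C\subset X$ accumulates at $x$ if every neighborhood of $x$ contains infinitely many points of $C$. A family $\mathcal N$ of subsets of $X$ is a $\mathsf p^*$-network at $x$ (here $\mathsf p$ is the family of all subsets of $X$) if for any neighborhood $O_x$ of $x$ and any set $C\subset X$ accumulating at $x$ there is $N\in\mathcal N$ with $x\in N\subset O_x$ and $N\cap C$ infinite. A $\mathsf p^*$-netbase for $X$ is a pair $(\mathcal E,\mathcal B)$ with $\mathcal E$ a family of entourages on $X$ and $\mathcal B$ an entourage base for $X$ such that for every $B\in\mathcal B$ and $x\in X$ the family $\{E[x]:E\in\mathcal E,\ E\subset B\}$ is a $\mathsf p^*$-network at $x$. $\chi_{\mathsf p^*}(X)$ is the smallest cardinal $\kappa$ for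 which there is a $\mathsf p^*$-netbase $(\mathcal E,\mathcal B)$ for $X$ with $|\mathcal E|\le\kappa$. $\chi(X)=\sup_{x\in X}\chi(x;X)$, where $\chi(x;X)$ is the smallest cardinality of a neighborhood base at $x$. $L(X)$ is the smallest cardinal $\kappa$ such that each open cover of $X$ has a subcover of cardinality $\le\kappa$. $aL_c(X)$ (resp. $wL_c(X)$) is the smallest cardinal $\kappa$ such that for any cover $\mathcal V$ of a closed subspace $C\subset X$ by open subsets of $X$ there is $\mathcal V'\subset\mathcal V$ with $|\mathcal V'|\le\kappa$ and $C\subset\bigcup_{V\in\mathcal V'}\overline V$ (resp. $C\subset\overline{\bigcup\mathcal V'}$). $c(X)$ is the smallest cardinal $\kappa$ such that every disjoint family of non-empty open subsets of $X$ has cardinality $\le\kappa$. A space is regular if every neighborhood of each point contains a closed neighborhood of that point.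
   Formalization: Here χ_{p*}(X) is taken as the smallest non-zero cardinal κ with the stated property: for discrete X the literal value is 0, and |X| ≤ 2^0 fails for every discrete X with at least two points. *)

(* Defs.v *)
From HB Require Import structures.
From mathcomp Require Import all_boot.
From mathcomp Require Import boolp classical_sets functions cardinality.
From mathcomp Require Import topology separation_axioms.

Set Implicit Arguments.
Unset Strict Implicit.
Unset Printing Implicit Defensive.

Local Open Scope classical_set_scope.
Local Open Scope card_scope.

(* A type K stands for the cardinal |K|: products of cardinals are products of
   types, and 2 ^ |K| is the cardinality of K -> bool. *)

Definition is_least_cardinal (P : Type -> Prop) (K : Type) : Prop :=
  P K /\ forall K' : Type, P K' -> [set: K] #<= [set: K'].

(* The branch False is a dummy: see least_cardinalP. *)
Definition least_cardinal (P : Type -> Prop) : Type :=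
  match pselect (exists K, is_least_cardinal P K) with
  | left exK => sval (cid exK)
  | right _ => False
  end.

Lemma inj_card_leT (T U : Type) (f : T -> U) : injective f -> [set: T] #<= [set: U].
Proof.
move=> finj.
have [|g] := (@injfunPex T U setT setT).2; last exact: inj_card_le.
by exists f => // x y _ _; exact: finj.
Qed.

Lemma card_leT_inj (T U : Type) : [set: T] #<= [set: U] -> exists f : T -> U, injective f.
Proof.
move=> /card_leP[f]; exists (fun x => \val (f (SigSub (mem_setT x)))) => x y /val_inj h.
have := @inj _ _ _ f (SigSub (mem_setT x)) (SigSub (mem_setT y)) .
by rewrite !inE => /(_ I I h) [].
Qed.

Lemma card_le_minimum (I : Type) (F : I -> Type) : inhabited I ->
  exists i, forall j, [set: F i] #<= [set: F j].
Proof.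
move=> [i0].
pose P (D : set (forall i, F i)) := forall i f g, D f -> D g -> f i = g i -> f = g.
have [|D [PD Dmax]] := @Zorn_bigcup (forall i, F i) P.
  move=> G GP tot i f g [A GA Af] [B GB Bg].
  by have [AB|BA] := tot _ _ GA GB; [apply: (GP _ GB) => //; exact: AB|apply: (GP _ GA) => //; exact: BA].
have [[i isurj]|nsurj] := pselect (exists i, forall a : F i, exists f, D f /\ f i = a).
  exists i => j; have [f fP] := choice isurj.
  apply: (@inj_card_leT _ _ (fun a => f a j)) => a b fab.
  have [Da <-] := fP a; have [Db <-] := fP b.
  by rewrite (PD _ _ _ Da Db fab).
have hP i : exists a : F i, forall f, D f -> f i <> a.
  apply: contrapT => na; apply: nsurj; exists i => a; apply: contrapT => nf.
  by apply: na; exists a => f Df fa; apply: nf; exists f.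
pose h i := sval (cid (hP i)).
have hE i f : D f -> f i <> h i by rewrite /h; case: cid => a /= /[apply].
exfalso; apply: (Dmax (D `|` [set h])).
  split; first by left.
  by move=> sub; exact: (hE i0 h (sub h (or_intror erefl))).
move=> i f g [Df|->] [Dg|->] // fg; first exact: PD fg.
  by have := hE i f Df fg.
by have := hE i g Dg (esym fg).
Qed.

Lemma least_cardinalP (P : Type -> Prop) (K : Type) :
  (forall K1 K2 : Type, [set: K1] #= [set: K2] -> P K1 -> P K2) ->
  P K -> is_least_cardinal P (least_cardinal P).
Proof.
move=> Pinv PK; rewrite /least_cardinal; case: pselect => [e|[]]; first by case: cid.
pose I := {A : set K | P {x | A x}}.
have eqP' (K1 : Type) : [set: K1] #<= [set: K] -> exists A : set K, [set: K1] #= [set: {x | A x}].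
  move=> /card_leT_inj[f finj].
  exists (range f). rewrite card_eq_le; apply/andP; split.
    have rf x : range f (f x) by exists x.
    apply: (@inj_card_leT _ {x | range f x} (fun x => exist _ (f x) (rf x))).
    by move=> x y [] /finj.
  apply: (@inj_card_leT {x | range f x} K1 (fun y : {x | range f x} => sval (cid2 (svalP y)))).
  move=> [x px] [y py] /=; case: cid2 => a _ /= ax; case: cid2 => b _ /= bx ab.
  by apply: eq_exist => /=; rewrite -ax -bx ab.
have [] := @card_le_minimum I (fun A => {x | sval A x}).
  have [A KA] := eqP' K (card_lexx _).
  by constructor; exists A; exact: Pinv KA PK.
move=> [A PA] /= Amin; exists {x | A x}; split=> // K' PK'.
have [[] /= Kmin] := @card_le_minimum bool (fun b => if b then {x | A x} else K') (inhabits true).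
  exact: (Kmin false).
have K'A := Kmin true; rewrite /= in K'A.
have AK : [set: {x | A x}] #<= [set: K].
  apply: (@inj_card_leT {x | A x} K (@sval _ _)) => -[x px] [y py] /= xy; exact: eq_exist.
have [B K'B] := eqP' K' (card_le_trans K'A AK).
have PB := Pinv _ _ K'B PK'.
apply: card_le_trans (Amin (exist _ B PB)) _.
by move: K'B; rewrite card_eq_le => /andP[].
Qed.

Section EntouragesAndNetworks.
Variable X : topologicalType.
Implicit Types (x : X) (C : set X) (N : set (set X)) (E B : set (X * X)).

Definition is_entourage E : Prop := forall x, E (x, x).

Definition nbhd_base x N : Prop :=
  (forall U, N U -> nbhs x U) /\
  (forall O, nbhs x O -> exists2 U, N U & U `<=` O).

(* xsection B x is the ball B[x] = {y | (x, y) \in B}. *)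
Definition entourage_base (BB : set (set (X * X))) : Prop :=
  [/\ forall B, BB B -> is_entourage B,
      forall B1 B2, BB B1 -> BB B2 ->
        exists2 B3, BB B3 & B3 `<=` B1 `&` B2
    & forall x, nbhd_base x [set xsection B x | B in BB]].

Definition accum_at C x : Prop :=
  forall U, nbhs x U -> infinite_set (U `&` C).

Definition pstar_network x N : Prop :=
  forall O C, nbhs x O -> accum_at C x ->
    exists U, [/\ N U, U x, U `<=` O & infinite_set (U `&` C)].

Definition pstar_netbase (EE BB : set (set (X * X))) : Prop :=
  [/\ forall E, EE E -> is_entourage E,
      entourage_base BB
    & forall B x, BB B ->
        pstar_network x
          [set xsection E x | E in [set E | EE E /\ E `<=` B]]].

End EntouragesAndNetworks.

Section CardinalInvariants.
Variable X : topologicalType.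
Implicit Types (VV : set (set X)) (C : set X).

(* The conjunct $|K| excludes the cardinal 0. It matters only if X is discrete: then no set
   accumulates at any point, the empty family is the first component of a
   p*-netbase, and the value 0 would make the bound |X| <= 2 ^ (0 * aLc X) false
   for every discrete X with at least two points. *)
Definition chi_pstar : Type :=
  least_cardinal (fun K => $|K| /\
    exists EE BB : set (set (X * X)),
      pstar_netbase EE BB /\ EE #<= [set: K]).

Definition chi_at (x : X) : Type :=
  least_cardinal (fun K =>
    exists N : set (set X), nbhd_base x N /\ N #= [set: K]).

(* The supremum of the cardinals chi_at x. *)
Definition chi : Type :=
  least_cardinal (fun K => forall x : X, [set: chi_at x] #<= [set: K]).

Definition lindelof_number : Type :=
  least_cardinal (fun K => forall VV,
    (forall V, VV V -> open V) -> \bigcup_(V in VV) V = [set: X] ->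
    exists WW : set (set X),
      [/\ WW `<=` VV, WW #<= [set: K] & \bigcup_(V in WW) V = [set: X]]).

Definition aLc : Type :=
  least_cardinal (fun K => forall C VV,
    closed C -> (forall V, VV V -> open V) -> C `<=` \bigcup_(V in VV) V ->
    exists WW : set (set X),
      [/\ WW `<=` VV, WW #<= [set: K]
        & C `<=` \bigcup_(V in WW) closure V]).

Definition wLc : Type :=
  least_cardinal (fun K => forall C VV,
    closed C -> (forall V, VV V -> open V) -> C `<=` \bigcup_(V in VV) V ->
    exists WW : set (set X),
      [/\ WW `<=` VV, WW #<= [set: K]
        & C `<=` closure (\bigcup_(V in WW) V)]).

Definition cellularity : Type :=
  least_cardinal (fun K => forall VV,
    (forall V, VV V -> open V) -> (forall V, VV V -> V !=set0) ->
    trivIset VV id -> VV #<= [set: K]).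

End CardinalInvariants.

(* Main.v *)
Require Import Defs.
From HB Require Import structures.
From mathcomp Require Import all_boot.
From mathcomp Require Import boolp classical_sets functions cardinality.
From mathcomp Require Import topology separation_axioms.

Set Implicit Arguments.
Unset Strict Implicit.
Unset Printing Implicit Defensive.

Local Open Scope classical_set_scope.
Local Open Scope card_scope.

(** The proof is the closing-off argument behind the classical bounds
    2 ^ (chi * L) and 2 ^ (chi * c), run with a netbase (EE, BB) instead of
    neighborhood bases. Fix an infinite K with |EE| <= |K|. Two facts about EE
    replace the bound on the character.

    - A point x in the closure of a set C but outside C is determined by few
      data. Choose a point of C in each ball E[x] that meets C. By the p*-network
      property x is in the closure of the chosen points a_E, and the traces of
      the balls E[x] on {a_E} determine x (trace_limit_closure,
      trace_limit_unique). So K-indexed families of points together with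
      relations on K suffice to reach every closure point.

    - For an entourage B of the base, the union of the E[x] with E in EE and
      E contained in B is a neighborhood of x, up to adding x itself
      (union_ball_nbhs): otherwise its complement accumulates at x, and the
      network property gives an E in EE contained in B whose ball meets this
      complement. Thus subsets of K code enough neighborhoods of every point.

    Consequently there are two operations on points, both of arity K and with at
    most 2 ^ |K| parameters: one picks the point with given traces, the other one
    picks a point outside the hull of a K-indexed family of coded neighborhoods,
    where the hull is the union of the closures or the closure of the union. The
    set F generated from one point by these operations has at most 2 ^ |K| points
    (operation_closure), because a generation history is a well-founded tree,
    determined by its labels along finite sequences of elements of K. F is closed
    by the first operation. If a point q were outside F, the separation axiom
    would give coded neighborhoods of the points of F such that no family of them
    has q in its hull; the covering property extracts K-many of them whose hull
    contains F, and the second operation yields a point of F outside this hull, a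
    contradiction (card_le_pow_netbase).

    All this needs |K * K| = |K| for infinite K (card_square). If the covering
    number is finite the space is finite and no larger than that number
    (card_le_covered). The remaining inequalities compare exponents: aLc <= L and
    wLc <= c hold for all spaces, and chi_pstar <= chi for nonempty ones because
    finite intersections of the neighborhood assignments x |-> U_k(x), k in K,
    form a netbase. For the empty space L = c = 0. *)

(** * Cardinals of products, powers and enumerated sets *)

Lemma card_leT_total (T U : Type) :
  [set: T] #<= [set: U] \/ [set: U] #<= [set: T].
Proof.
have [] := @card_le_minimum bool (fun b => if b then T else U) (inhabits true).
by case=> H; [left; exact: (H false)|right; exact: (H true)].
Qed.

Lemma card_le_pow (T : Type) : [set: T] #<= [set: T -> bool].
Proof.
apply: (@inj_card_leT _ _ (fun x y => `[< x = y >])) => x y E.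
by apply/asboolP; rewrite (congr1 (fun f => f y) E); apply/asboolP.
Qed.

Lemma card_le_prodr (T U : Type) : $|T| -> [set: U] #<= [set: T * U].
Proof. by move=> [t]; apply: (@inj_card_leT _ _ (pair t)) => u v []. Qed.

Lemma card_le_prodl (T U : Type) : $|U| -> [set: T] #<= [set: T * U].
Proof. by move=> [u]; apply: (@inj_card_leT _ _ (fun t => (t, u))) => s t []. Qed.

Lemma card_prod_le (T U T' U' : Type) : 
  [set: T] #<= [set: T'] -> [set: U] #<= [set: U'] ->
  [set: T * U] #<= [set: T' * U'].
Proof.
move=> /card_leT_inj[f fi] /card_leT_inj[g gi].
apply: (@inj_card_leT _ _ (fun p => (f p.1, g p.2))).
by move=> [a b] [a' b'] [/fi-> /gi->].
Qed.

Lemma card_pow_le (T U : Type) : [set: T] #<= [set: U] ->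
  [set: T -> bool] #<= [set: U -> bool].
Proof.
move=> /card_leT_inj[f fi].
apply: (@inj_card_leT _ _ (fun (A : T -> bool) u =>
  `[< exists2 t, A t & f t = u >])).
move=> A B AB; apply/funext => t.
have E (C : T -> bool) : `[< exists2 t', C t' & f t' = f t >] = C t.
  by apply/asboolP/idP => [[t' Ct' /fi<-]|Ct] //; exists t.
by rewrite -(E A) -(E B); exact: (congr1 (fun g => g (f t)) AB).
Qed.

(** A surjection from K indexes the members of A, so that families of sets can be
    handled as families of elements of K. *)
Lemma card_le_enum (T K : Type) (A : set T) :
  A !=set0 -> A #<= [set: K] -> exists e : K -> T, range e = A.
Proof.
move=> [d Ad] AK.
have /card_leT_inj[f fi] : [set: A] #<= [set: K].
  by apply: card_le_trans AK; have := card_setT A; rewrite card_eq_le => /andP[].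
have /choice[e eP] (k : K) : exists t, A t /\ forall a : A, f a = k -> t = \val a.
  have [[a <-]|na] := pselect (exists a, f a = k).
    by exists (\val a); split; [exact: set_valP|move=> b /fi->].
  by exists d; split=> // a ak; case: na; exists a.
exists e; apply/seteqP; split=> [_ [k _ <-]|a Aa]; first by case: (eP k).
exists (f (SigSub (mem_set Aa))) => //.
by case: (eP (f (SigSub (mem_set Aa)))) => _ /(_ _ erefl)->.
Qed.

Lemma card_pow_sum_le (T : Type) :
  [set: (T -> bool) + (T -> bool)] #<= [set: option T -> bool].
Proof.
(* The value at None tells the summands apart. *)
pose c (l : (T -> bool) + (T -> bool)) (o : option T) :=
  match l, o with
  | inl m, Some t | inr m, Some t => m t
  | inl _, None => true
  | inr _, None => false
  end.
apply: (@inj_card_leT _ _ c) => -[m|m] [m'|m'] E.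
- by congr inl; apply/funext => t; exact: (congr1 (fun f => f (Some t)) E).
- by have := congr1 (fun f => f None) E.
- by have := congr1 (fun f => f None) E.
- by congr inr; apply/funext => t; exact: (congr1 (fun f => f (Some t)) E).
Qed.

(** * Infinite cardinals are idempotent *)

(** Graphs of partial injections of K * K into K, ordered by inclusion, are the
    objects to which Zorn's lemma applies. A pairing graph is the graph of an
    injection A * A -> A; the set A is recovered from its diagonal. *)
Definition diag_dom (K : Type) (G : set (K * K * K)) : set K :=
  [set a | exists c, G (a, a, c)].

Definition pairing_graph (K : Type) (G : set (K * K * K)) : Prop :=
  [/\ forall a b c, G (a, b, c) -> [/\ diag_dom G a, diag_dom G b & diag_dom G c],
      forall a b, diag_dom G a -> diag_dom G b -> exists c, G (a, b, c),
      forall p c c', G (p, c) -> G (p, c') -> c = c'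
    & forall p p' c, G (p, c) -> G (p', c) -> p = p'].

Definition transported_graph (K S : Type) (e : S -> K) (f : S * S -> S) :
  set (K * K * K) := range (fun p => (e p.1, e p.2, e (f p))).

Lemma mem_transported_graph (K S : Type) (e : S -> K) (f : S * S -> S) p :
  transported_graph e f (e p.1, e p.2, e (f p)).
Proof. by exists p. Qed.

(** Both the graph that starts the construction (S = nat) and the extension of a
    given graph on A (S = bool * A) have this form. *)
Lemma pairing_graph_transported (K S : Type) (e : S -> K) (f : S * S -> S) :
  injective e -> injective f -> pairing_graph (transported_graph e f).
Proof.
move=> ei fi.
have dom s : diag_dom (transported_graph e f) (e s).
  by exists (e (f (s, s))), (s, s).
have domP a : diag_dom (transported_graph e f) a -> exists s, a = e s.
  by move=> [c [[s t] _ [<- _ _]]]; exists s.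
split.
- by move=> a b c [[s t] _ [<- <- <-]]; split; exact: dom.
- move=> a b /domP[s ->] /domP[t ->].
  by exists (e (f (s, t))), (s, t).
- move=> p c c' [[s t] _ [<- <-]] [[s' t'] _ [/= /ei<- /ei<- <-]] //.
- by move=> p p' c [[s t] _ [<- <-]] [[s' t'] _ [<- /ei/fi[-> ->]]].
Qed.

Lemma pairing_graph_bigcup (K : Type) (F : set (set (K * K * K))) :
  (forall G, F G -> pairing_graph G) -> total_on F subset ->
  pairing_graph (\bigcup_(G in F) G).
Proof.
move=> FP tot.
have domS G G' : G `<=` G' -> diag_dom G `<=` diag_dom G'.
  by move=> GG' a [c /GG'?]; exists c.
have domF G : F G -> diag_dom G `<=` diag_dom (\bigcup_(G in F) G).
  by move=> FG; apply: domS => p Gp; exists G.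
have pairF G G' : F G -> F G' -> exists H, [/\ F H, G `<=` H & G' `<=` H].
  move=> FG FG'; have [?|?] := tot _ _ FG FG'.
    by exists G'; split=> //; exact: subset_refl.
  by exists G; split=> //; exact: subset_refl.
split.
- move=> a b c [G FG Gabc]; have [/(_ _ _ _ Gabc)[? ? ?] _ _ _] := FP _ FG.
  by split; apply: domF FG _ _.
- move=> a b [c [G FG Gc]] [d [G' FG' Gd]].
  have [H [FH GH G'H]] := pairF _ _ FG FG'; have [_ Htot _ _] := FP _ FH.
  have Ha : diag_dom H a by exists c; exact: GH.
  have Hb : diag_dom H b by exists d; exact: G'H.
  by have [x Hx] := Htot a b Ha Hb; exists x, H.
- move=> p c c' [G FG Gc] [G' FG' Gc'].
  have [H [FH GH G'H]] := pairF _ _ FG FG'; have [_ _ Hfun _] := FP _ FH.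
  exact: Hfun (GH _ Gc) (G'H _ Gc').
- move=> p p' c [G FG Gc] [G' FG' Gc'].
  have [H [FH GH G'H]] := pairF _ _ FG FG'; have [_ _ _ Hinj] := FP _ FH.
  exact: Hinj (GH _ Gc) (G'H _ Gc').
Qed.

(** A square-idempotent A at least as large as its complement absorbs K: the
    elements of the complement are placed in A as well, and the two kinds are kept
    apart by pairing them with u and with v. *)
Lemma card_square_of_subset (K : Type) (A : set K)
    (f : {x | A x} * {x | A x} -> {x | A x})
    (g : {x | ~ A x} -> {x | A x}) (u v : {x | A x}) :
  injective f -> injective g -> u <> v -> [set: K * K] #<= [set: K].
Proof.
move=> fi gi uv.
(* The injection of K into A; K * K then embeds through h on both coordinates. *)
pose h k := match pselect (A k) with
  | left Ak => f (exist _ k Ak, u) | right nAk => f (g (exist _ k nAk), v) end.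
have hi : injective h.
  move=> x y; rewrite /h; case: pselect => Ax; case: pselect => Ay /fi[].
  - by [].
  - by move=> _ /uv.
  - by move=> _ /esym/uv.
  - by move=> /gi[].
apply: (@inj_card_leT _ _ (fun p => sval (f (h p.1, h p.2)))).
have vi : injective (@sval K A).
  by move=> [x px] [y py] /= xy; exact: eq_exist.
by move=> [x y] [z t] /vi/fi[/hi-> /hi->].
Qed.

(** Two disjoint copies of S, indexed by bool, inherit a pairing that extends the
    one on the copy true: the other three blocks all go to the copy false, and
    the tag keeps them apart. *)
Lemma square_double (S : Type) (f : S * S -> S) (tag : bool * bool -> S) :
  injective f -> injective tag ->
  injective (fun p : (bool * S) * (bool * S) =>
    (p.1.1 && p.2.1, if p.1.1 && p.2.1 then f (p.1.2, p.2.2)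
       else f (f (p.1.2, p.2.2), tag (p.1.1, p.2.1)))).
Proof.
move=> fi ti [[s a] [t b]] [[s' a'] [t' b']] /= [st].
rewrite -st; case: (boolP (s && t)) => [/andP[sT tT]|_].
  by move: st; rewrite sT tT => /esym/andP[-> ->] /fi[-> ->].
by move=> /fi[] /fi[-> ->] /ti[-> ->].
Qed.

(** A maximal pairing graph above a countable one lives on a set A. If A were no
    larger than its complement, a copy of A in the complement would allow a proper
    extension; hence A is larger than its complement and absorbs K. *)
Theorem card_square (K : Type) :
  infinite_set [set: K] -> [set: K * K] #<= [set: K].
Proof.
move=> /infiniteP/card_leT_inj[i ii].
pose G0 := transported_graph i (@pickle (nat * nat)%type).
have G0P : pairing_graph G0.
  by apply: pairing_graph_transported => //; exact: pcan_inj pickleK.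
(* The empty chain has union set0, so set0 has to be admitted; maximality excludes
   it because G0 is larger. *)
have [F FP tot|G [[GP G0G] Gmax]] :=
    @Zorn_bigcup _ (fun G => pairing_graph G /\ (G = set0 \/ G0 `<=` G)).
  split; first by apply: pairing_graph_bigcup => // G /FP[].
  have [[G FG G0G]|nG] := pselect (exists2 G, F G & G0 `<=` G).
    by right=> p /G0G Gp; exists G.
  left; apply/seteqP; split=> // p [G FG].
  by have [_ [->//|G0G]] := FP _ FG; case: nG; exists G.
have {}G0G : G0 `<=` G.
  case: G0G => // GE; exfalso; apply: (Gmax G0); last by split => //; right.
  rewrite GE; split=> // /(_ (i 0, i 0, i (pickle (0,0)))); apply.
  by exists (0, 0).
pose A := diag_dom G; pose S := {x | A x}.
have Ai n : A (i n) by exists (i (pickle (n, n))); apply: G0G; exists (n, n).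
pose j n : S := exist _ (i n) (Ai n).
have ji : injective j by move=> m n [/ii].
have [G1 G2 G3 G4] := GP.
have vi : injective (@sval K A).
  by move=> [x px] [y py] /= xy; exact: eq_exist.
have /choice[f fP] (p : S * S) : exists c : S, G (sval p.1, sval p.2, sval c).
  have [c Gc] := G2 _ _ (svalP p.1) (svalP p.2); have [_ _ Ac] := G1 _ _ _ Gc.
  by exists (exist _ c Ac).
have fi : injective f.
  move=> [a b] [a' b'] E; have := fP (a, b); rewrite E.
  by move=> /(G4 _ _ _ (fP (a', b')))[/vi-> /vi->].
have [/card_leT_inj[g gi]|/card_leT_inj[g gi]] :=
    card_leT_total {x | ~ A x} S.
  by apply: (card_square_of_subset (u := j 0) (v := j 1)) fi gi _ => /ji.
(* Now a copy of A lies in the complement, and e embeds two disjoint copies of A. *)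
pose e (p : bool * S) : K := if p.1 then sval p.2 else sval (g p.2).
have ei : injective e.
  have wi : injective (@sval K (fun x => ~ A x)).
    by move=> [x px] [y py] /= xy; exact: eq_exist.
  move=> [[] a] [[] b]; rewrite /e /=.
  - by move/vi->.
  - by move=> ab; have := svalP (g b); rewrite -ab => /(_ (svalP a)).
  - by move=> ab; have := svalP (g a); rewrite ab => /(_ (svalP b)).
  - by move/wi/gi->.
pose tag (p : bool * bool) := j (pickle p).
have tagi : injective tag by move=> p q /ji; exact: pcan_inj pickleK _ _.
have f'i := square_double fi tagi.
exfalso; apply: (Gmax _ _ (conj (pairing_graph_transported ei f'i) _)).
  split.
    move=> [[a b] c] Gabc; have [Aa Ab _] := G1 _ _ _ Gabc.
    exists ((true, exist _ a Aa), (true, exist _ b Ab)) => //=; rewrite /e /=.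
    by congr (_, _); exact: G3 _ _ _ (fP (exist _ a Aa, exist _ b Ab)) Gabc.
  move=> sub.
  have [Aj _ _] := G1 _ _ _
    (sub _ (mem_transported_graph e _ ((false, j 0), (false, j 0)))).
  exact: svalP (g (j 0)) Aj.
right=> _ [[m n] _ <-]; exists ((true, j m), (true, j n)) => //=.
congr (_, _); apply: (G3 _ _ _ (fP (j m, j n))).
by apply: G0G; exists (m, n).
Qed.

(** * Closing a point under operations of infinite arity *)

(** Iterated pairing is injective on sequences of a given length, so the length is
    recorded as well. *)
Lemma card_seq (K : Type) : infinite_set [set: K] -> [set: seq K] #<= [set: K].
Proof.
move=> Kinf; have /card_leT_inj[p pi] := card_square Kinf.
have /infiniteP/card_leT_inj[i ii] := Kinf.
pose fold (s : seq K) := foldr (fun x c => p (x, c)) (i 0) s.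
have foldi s t : size s = size t -> fold s = fold t -> s = t.
  elim: s t => [|x s IHs] [|y t] //= [] st /pi[-> st']; congr cons; exact: IHs.
apply: (@inj_card_leT _ _ (fun s => p (i (size s), fold s))).
by move=> s t /pi[/ii]; exact: foldi.
Qed.

Lemma card_le_option (K : Type) :
  infinite_set [set: K] -> [set: option K] #<= [set: K].
Proof.
move=> /card_seq; apply: card_le_trans.
apply: (@inj_card_leT _ _
  (fun o : option K => if o is Some x then [:: x] else [::])).
by move=> [x|] [y|] // [->].
Qed.

(** A term is a generation history: each node has a label in L, and one subterm for
    each element of K. *)
Inductive op_term (L K : Type) : Type :=
  | op_seed
  | op_node of L & (K -> op_term L K).
Arguments op_seed {L K}.

Section OperationClosure.
Variables (L K T : Type) (op : L -> (K -> T) -> T) (t0 : T).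

Fixpoint op_eval (w : op_term L K) : T :=
  if w is op_node l b then op l (fun k => op_eval (b k)) else t0.

Variable g : L -> K -> bool.

(** The code of a term lists what is found at the end of each path s from the
    root: None asks whether there is a node, and Some k for the k-th bit of its
    label. *)
Fixpoint op_code (w : op_term L K) (s : seq K) (o : option K) : bool :=
  match w, s with
  | op_seed, _ => false
  | op_node l _, [::] => if o is Some k then g l k else true
  | op_node _ b, k :: s' => op_code (b k) s' o
  end.

Lemma op_code_inj : injective g -> injective op_code.
Proof.
move=> gi; elim=> [|l b IHb] [|l' b'] E //.
- by have := congr1 (fun c => c [::] None) E.
- by have := congr1 (fun c => c [::] None) E.
congr op_node.
  by apply: gi; apply/funext => k; exact: (congr1 (fun c => c [::] (Some k)) E).
apply/funext => k; apply: IHb.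
by apply/funext => s; exact: (congr1 (fun c => c (k :: s)) E).
Qed.

End OperationClosure.

(** The values of all terms form such a set. Because K-ary trees already contain all
    K-indexed families of earlier terms, one step of the inductive type does the
    work of a recursion of length the successor of |K|. *)
Theorem operation_closure (L K T : Type) (op : L -> (K -> T) -> T) (t0 : T) :
  infinite_set [set: K] -> [set: L] #<= [set: K -> bool] ->
  exists F : set T, [/\ F t0,
    forall l a, (forall k, F (a k)) -> F (op l a) &
    F #<= [set: K -> bool]].
Proof.
move=> Kinf /card_leT_inj[g gi].
exists (range (op_eval op t0)); split.
- by exists op_seed.
- move=> l a /(_ _)/cid2-/all_sig2[w _ wa]; exists (op_node l w) => //=.
  by congr op; apply/funext.
apply: card_le_trans (card_image_le _ _) _.
apply: (@card_le_trans _ _ _ [set: seq K * option K -> bool]).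
  apply: (@inj_card_leT _ _ (fun w p => op_code g w p.1 p.2)) => w w' E.
  apply: op_code_inj gi _ _ _; apply/funext => s; apply/funext => o.
  exact: (congr1 (fun c => c (s, o)) E).
apply: card_pow_le; apply: card_le_trans (card_square Kinf).
by apply: card_prod_le; [exact: card_seq|exact: card_le_option].
Qed.

(** * Entourages of a netbase as neighborhoods and as codes of points *)

Lemma closure_accum (X : topologicalType) (C : set X) (x : X) :
  accessible_space X -> closure C x -> ~ C x -> accum_at C x.
Proof.
move=> accX Cx nCx U Ux fin.
have : nbhs x (U `&` ~` (U `&` C)).
  apply: filterI => //; apply: open_nbhs_nbhs; split; last by case.
  by apply: closed_openC; move/accessible_finite_set_closed: accX; apply.
by move=> /Cx [y [Cy [Uy /not_andP[]]]].
Qed.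

Section Entourages.
Variables (X : topologicalType) (K : Type) (EE BB : set (set (X * X))).
Hypothesis accX : accessible_space X.
Hypothesis netEB : pstar_netbase EE BB.
Variable e : K -> set (X * X).
Hypothesis Ee : EE `<=` range e.

(** The neighborhood of x coded by s. Including x itself matters only at isolated
    points, where the p*-networks may be empty. *)
Definition union_ball (s : K -> bool) (x : X) : set X :=
  [set y | x = y \/ exists k, s k /\ e k (x, y)].

(** If the union were not a neighborhood, its complement would accumulate at x and
    therefore meet a ball E[x] with E in EE and E contained in B; but these balls
    are part of the union. *)
Lemma union_ball_nbhs B x : BB B ->
  let U := union_ball (fun k => `[< e k `<=` B >]) x in
  nbhs x U /\ U `<=` xsection B x.
Proof.
move=> BB_B U; have [EEe [BBe BBI BBx] net] := netEB.
split; last first.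
  move=> y [<-|[k [/asboolP ekB eky]]]; apply/xsectionP; first exact: BBe.
  exact: ekB.
apply: contrapT => nU.
have accU : accum_at (~` U) x.
  apply: closure_accum => //; last by apply; left.
  move=> V Vx; apply: contrapT => VU; apply: nU; apply: filterS Vx => y Vy.
  by apply: contrapT => nUy; apply: VU; exists y.
have [_ [[E [EE_E EB] <-] _ _ /infinite_setN0[y [Ey]]]] :=
  net _ _ BB_B _ _ filterT accU.
have [k _ ekE] := Ee EE_E; rewrite -ekE in EB Ey.
by apply; right; exists k; split; [exact/asboolP|exact/xsectionP].
Qed.

(** The pair (m, a) serves as a code of x. Points of range a are excluded so that
    range a accumulates at x and the p*-networks apply to it. *)
Definition trace_limit (m : K * K -> bool) (a : K -> X) (x : X) : Prop :=
  [/\ closure (range a) x, ~ range a x &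
      forall i j, m (i, j) = `[< e i (x, a j) >]].

(** For distinct x and y, a single B in the base has disjoint balls at x and y,
    because the base is directed. Some E contained in B catches a point a j in
    E[x], and equal traces put a j in E[y] too, so in both balls of B. *)
Lemma trace_limit_unique m a x y : hausdorff_space X ->
  trace_limit m a x -> trace_limit m a y -> x = y.
Proof.
move=> hausX [clx nx mx] [cly ny my].
have [EEe [BBe BBI BBx] net] := netEB.
apply: hausX => U V Ux Vy.
have [_ [B1 BB1 <-] B1U] := (BBx x).2 _ Ux.
have [_ [B2 BB2 <-] B2V] := (BBx y).2 _ Vy.
have [B BB_B BI] := BBI _ _ BB1 BB2.
have [_ [[E [EE_E EB] <-] _ EU /infinite_setN0[z [Ez [j _ ajz]]]]] :=
  net _ _ BB_B _ _ Ux (closure_accum accX clx nx).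
have [i _ eiE] := Ee EE_E.
exists z; split; first exact: EU.
apply/B2V/xsectionP; suff /EB/BI[] : E (y, z) by [].
rewrite -eiE -ajz; apply/asboolP; rewrite -my mx; apply/asboolP.
by rewrite eiE ajz; exact/xsectionP.
Qed.

(** One point of C in every ball E[x] that meets C is enough to have x in the
    closure, since by the network property each neighborhood of x contains such a
    ball. *)
Lemma trace_limit_closure (C : set X) x : closure C x -> ~ C x ->
  exists m a, (forall k, C (a k)) /\ trace_limit m a x.
Proof.
move=> clx nCx; have [EEe [BBe BBI BBx] net] := netEB.
have accC := closure_accum accX clx nCx.
have [c0 [Cc0 _]] := clx _ filterT.
have /choice[a aP] (k : K) : exists c, C c /\
    ((xsection (e k) x `&` C) !=set0 -> e k (x, c)).
  have [[c [/xsectionP ekc Cc]]|nc] := pselect ((xsection (e k) x `&` C) !=set0).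
    by exists c; split.
  by exists c0; split.
exists (fun p => `[< e p.1 (x, a p.2) >]), a.
split; first by move=> k; case: (aP k).
split=> //; last by move=> [k _ akx]; apply: nCx; rewrite -akx; case: (aP k).
move=> O Ox.
have [_ [B BB_B _] _] := (BBx x).2 _ Ox.
have [_ [[E [EE_E EB] <-] _ EU /infinite_setN0 EC]] := net _ _ BB_B _ _ Ox accC.
have [k _ ekE] := Ee EE_E; rewrite -ekE in EU EC.
exists (a k); split; first by exists k.
by apply/EU/xsectionP; case: (aP k) => _; apply.
Qed.

End Entourages.

(** * The cardinality bound for an abstract covering property *)

(** The common form of the covering properties that define aLc and wLc; the hull h
    sends WW to the union of the closures, or to the closure of the union. *)
Definition covered_by (X : topologicalType) (h : set (set X) -> set X) (K : Type) :
    Prop :=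
  forall C VV,
    closed C -> (forall V, VV V -> open V) -> C `<=` \bigcup_(V in VV) V ->
    exists WW : set (set X), [/\ WW `<=` VV, WW #<= [set: K] & C `<=` h WW].

(** What the argument needs from the separation axioms: neighborhoods of the points
    of C so small that the hull of any family of their subsets misses q. *)
Definition point_separating (X : topologicalType) (h : set (set X) -> set X) :
    Prop :=
  forall C q, closed C -> ~ C q -> exists O : X -> set X,
    (forall x, C x -> nbhs x (O x)) /\
    forall WW, (forall W, WW W -> exists2 x, C x & W `<=` O x) -> ~ h WW q.

Lemma covered_by_card_le (X : topologicalType) (h : set (set X) -> set X)
    (K1 K2 : Type) :
  [set: K1] #<= [set: K2] -> covered_by h K1 -> covered_by h K2.
Proof.
move=> K12 cov C VV Ccl VVo CVV; have [WW [? WWK ?]] := cov C VV Ccl VVo CVV.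
by exists WW; split => //; exact: card_le_trans WWK K12.
Qed.

(** Closing a point x0 under the two operations of op gives a closed set F that
    contains a point outside the hull of each K-indexed family of coded
    neighborhoods of its points, unless this hull is the whole space. Hence no
    such family can separate F from a point q. *)
Theorem card_le_pow_netbase (X : topologicalType) (K : Type)
    (h : set (set X) -> set X) (EE BB : set (set (X * X))) :
  hausdorff_space X -> pstar_netbase EE BB -> EE #<= [set: K] ->
  infinite_set [set: K] -> covered_by h K -> point_separating h ->
  [set: X] #<= [set: K -> bool].
Proof.
move=> hausX netEB EEK Kinf covK seph.
have [[x0 _]|nX] := pselect (exists x : X, True); last first.
  have -> : [set: X] = set0 by apply/seteqP; split=> // x; case: nX; exists x.
  exact: card_ge0.
have accX := hausdorff_accessible hausX.
have [e Ee] : exists e : K -> set (X * X), EE `<=` range e.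
  have [->|/set0P EE0] := eqVneq EE set0; first by exists (fun=> setT).
  by have [e <-] := card_le_enum EE0 EEK; exists e.
pose ball (m : K * K -> bool) (a : K -> X) k :=
  interior (union_ball e (fun j => m (k, j)) (a k)).
pose op (l : (K * K -> bool) + (K * K -> bool)) (a : K -> X) : X :=
  match l with
  | inl m => xget x0 (trace_limit e m a)
  | inr m => xget x0 (~` h (range (ball m a)))
  end.
have [|F [F0 Fop FK]] := operation_closure op x0 Kinf.
  apply: card_le_trans (card_pow_sum_le _) _.
  apply: card_pow_le; apply: card_le_trans (card_le_option _) (card_square Kinf).
  move/infiniteP: Kinf => natK; apply/infiniteP; apply: card_le_trans natK _.
  by apply: (@inj_card_leT _ _ (fun k => (k, k))) => k k' [].
have Fclosed : closed F.
  move=> x clx; apply: contrapT => nFx.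
  have [m [a [Fa lim]]] := trace_limit_closure accX netEB Ee clx nFx.
  apply: nFx; have := Fop (inl m) a Fa => /=.
  case: xgetP => [y _ limy Fy|/(_ x)//].
  by rewrite (trace_limit_unique accX netEB Ee hausX lim limy).
suff FT : F = setT by rewrite -FT.
apply/seteqP; split=> // q _; apply: contrapT => nFq.
have [O [OF Oh]] := seph F q Fclosed nFq.
have [_ [_ _ BBx] _] := netEB.
have /choice[B BP] (x : X) : exists B, F x -> BB B /\ xsection B x `<=` O x.
  have [Fx|nFx] := pselect (F x); last by exists setT.
  by have [_ [B BB_B <-] BO] := (BBx x).2 _ (OF x Fx); exists B.
(* The subset of K that codes a neighborhood of x inside O x: the indices of the
   entourages contained in B x. *)
pose V x := interior (union_ball e (fun k => `[< e k `<=` B x >]) x).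
have [|||WW [WWV WWK FWW]] := covK F [set V x | x in F].
- exact: Fclosed.
- by move=> _ [x _ <-]; exact: open_interior.
- move=> x Fx; exists (V x); first by exists x.
  have [BB_B _] := BP x Fx.
  exact: (union_ball_nbhs accX netEB Ee x BB_B).1.
(* Separating x0 from the closed set set0 shows that the hull of the empty family
   misses x0. *)
have [W0 WW0] : WW !=set0.
  apply/set0P/eqP => WW0; have [O' [_ /(_ WW)]] := seph set0 x0 closed0 id.
  by rewrite WW0 => /(_ (fun _ => False_rect _)); apply; rewrite -WW0; exact: FWW.
have [w wE] := card_le_enum (ex_intro _ W0 WW0) WWK.
have wWW k : WW (w k) by rewrite -wE; exists k.
have /choice[a aP] k : exists x, F x /\ V x = w k.
  by have [x Fx Vx] := WWV _ (wWW k); exists x.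
pose m (p : K * K) := `[< e p.2 `<=` B (a p.1) >].
have ballE : range (ball m a) = WW.
  apply/seteqP; split.
    by move=> _ [k _ <-]; have [_ Va] := aP k; have := wWW k; rewrite -Va.
  rewrite -wE => _ [k _ <-]; exists k => //; by have [_ <-] := aP k.
have nhq : ~ h WW q.
  apply: Oh => W /WWV[x Fx <-]; exists x => //.
  have [BB_B BO] := BP x Fx.
  apply: subset_trans (@interior_subset _ _) (subset_trans _ BO).
  exact: (union_ball_nbhs accX netEB Ee x BB_B).2.
have := Fop (inr m) a (fun k => (aP k).1); rewrite /op ballE.
by case: xgetP => [y _ nhy /FWW//|/(_ q)//].
Qed.

(** For each i separate the other points of range d from d i, and intersect at each
    point the finitely many neighborhoods obtained. A subfamily that omits the
    neighborhood of d i then has a hull that misses d i, so the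
    neighborhoods of all n points are required in order to cover range d. *)
Lemma card_le_covered (X : topologicalType) (h : set (set X) -> set X)
    (K : Type) n (d : 'I_n -> X) :
  accessible_space X -> covered_by h K -> point_separating h -> injective d ->
  [set: 'I_n] #<= [set: K].
Proof.
move=> accX covK seph di; case: n => [|n] in d di *.
  by have -> : [set: 'I_0] = set0; [apply/seteqP; split=> // -[]|exact: card_ge0].
have closed_image (D : set 'I_n.+1) : closed (d @` D).
  by move/accessible_finite_set_closed: accX; apply; exact: finite_image.
have /choice[O OP] (i : 'I_n.+1) : exists O : X -> set X,
    (forall j, j <> i -> nbhs (d j) (O (d j))) /\
    forall WW, (forall W, WW W -> exists2 j, j <> i & W `<=` O (d j)) ->
      ~ h WW (d i).
  have [|O [OC Oh]] := seph (d @` [set j | j <> i]) (d i) (closed_image _).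
    by move=> [j /= ji /di].
  exists O; split=> [j ji|WW WWO]; first by apply: OC; exists j.
  by apply: Oh => W /WWO[j ji WO]; exists (d j) => //; exists j.
pose N j := interior [set y | forall i, j <> i -> O i (d j) y].
have Nd j : N j (d j).
  apply: filter_forall => i.
  have [->|/eqP ji] := eqVneq j i; first by apply: nearW.
  by apply: filterS ((OP i).1 j ji).
have [|||WW [WWN WWK dWW]] := covK (range d) (range N).
- exact: closed_image.
- by move=> _ [j _ <-]; exact: open_interior.
- by move=> _ [j _ <-]; exists (N j); [exists j|exact: Nd].
have /choice[r rP] (W : set X) : exists j, WW W -> N j = W.
  have [/WWN[j _ <-]|nW] := pselect (WW W); first by exists j.
  by exists ord0.
apply: card_le_trans WWK; apply: card_le_trans (card_image_le r WW).
apply: subset_card_le => i _; apply: contrapT => ni.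
have [_ Oh] := OP i; apply: (Oh WW); last by apply: dWW; exists i.
move=> W WW_W; have ri : r W <> i by move=> ri; apply: ni; exists W.
exists (r W) => //; rewrite -{1}(rP W WW_W) => y /interior_subset; exact.
Qed.

(** For infinite K2 the product K1 * K2 is infinite and bounds both the netbase and
    the covering number. For finite K2 the space is finite. *)
Theorem card_le_pow_cover (X : topologicalType) (h : set (set X) -> set X)
    (K1 K2 : Type) (EE BB : set (set (X * X))) :
  hausdorff_space X -> pstar_netbase EE BB -> EE #<= [set: K1] -> $|K1| ->
  covered_by h K2 -> point_separating h ->
  [set: X] #<= [set: K1 * K2 -> bool].
Proof.
move=> hausX netEB EEK K1n0 cov seph.
have K2K := card_le_prodr K2 K1n0.
have [K2fin|K2inf] := pselect (finite_set [set: K2]); last first.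
  have [k2 _] := infinite_setN0 K2inf.
  apply: card_le_pow_netbase netEB _ _ _ seph => //.
  - by apply: card_le_trans EEK _; exact: card_le_prodl.
  - by apply/infiniteP; apply: card_le_trans K2K; exact/infiniteP.
  - exact: covered_by_card_le K2K cov.
apply: card_le_trans (card_le_pow _); apply: card_le_trans K2K.
have accX := hausdorff_accessible hausX.
(* Every finite number of points of X is bounded by |K2|; in particular X is
   finite. *)
have K2ge n : [set: 'I_n] #<= [set: X] -> [set: 'I_n] #<= [set: K2].
  by move=> /card_leT_inj[d di]; exact: card_le_covered accX cov seph di.
have ordE n : `I_n #<= [set: 'I_n] /\ [set: 'I_n] #<= `I_n.
  by have := @card_II n; rewrite card_eq_le => /andP[].
have [/finite_setP[n]|/infiniteP natX] := pselect (finite_set [set: X]).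
  rewrite card_eq_le => /andP[Xn nX].
  apply: card_le_trans Xn _; apply: card_le_trans (ordE n).1 _.
  by apply: K2ge; exact: card_le_trans (ordE n).2 nX.
have /finite_setP[n] := K2fin; rewrite card_eq_le => /andP[Kn _].
have : `I_n.+1 #<= `I_n.
  apply: card_le_trans (ordE _).1 _; apply: card_le_trans _ Kn.
  apply: K2ge; apply: card_le_trans (ordE _).2 _.
  by apply: card_le_trans natX; exact: card_leT.
by rewrite card_le_II ltnn.
Qed.

(** * The two separation axioms *)

Lemma point_separating_bigcup_closure (X : topologicalType) : hausdorff_space X ->
  point_separating (fun WW : set (set X) => \bigcup_(W in WW) closure W).
Proof.
move=> hausX C q _ nCq.
have /choice[O OP] (x : X) : exists O, C x -> nbhs x O /\ ~ closure O q.
  have [Cx|nCx] := pselect (C x); last by exists setT.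
  have : ~ cluster (nbhs x) q by move=> /hausX xq; apply: nCq; rewrite -xq.
  move=> /existsNP[O /existsNP[V /not_implyP[Ox /not_implyP[Vq nOV]]]].
  by exists O => _; split=> // clO; apply: nOV; exact: clO.
exists O; split=> [x /OP[]//|WW WWO [W /WWO[x /OP[_ nOq] WO]]].
by move=> /(closureS WO).
Qed.

(** A closed neighborhood of q that misses C has an open complement, which serves
    as the neighborhood of all points of C at once. *)
Lemma point_separating_closure_bigcup (X : topologicalType) : regular_space X ->
  point_separating (fun WW : set (set X) => closure (\bigcup_(W in WW) W)).
Proof.
move=> regX C q Ccl nCq.
have [|V Vq VC] := regX q (~` C).
  by apply: open_nbhs_nbhs; split=> //; exact: closed_openC.
exists (fun=> ~` closure V); split=> [x Cx|WW WWO].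
  apply: open_nbhs_nbhs; split; first exact/closed_openC/closed_closure.
  by move=> /VC.
move=> /(_ V Vq)[y [[W /WWO[x _ WV] Wy] Vy]]; apply: WV Wy _; exact: subset_closure.
Qed.

(** * The cardinal invariants and their comparison *)

(** The balls of a base are neighborhoods, so every set that accumulates at x meets
    them in infinite sets; directedness makes them arbitrarily small inside B. *)
Lemma pstar_netbase_refl (X : topologicalType) (BB : set (set (X * X))) :
  entourage_base BB -> pstar_netbase BB BB.
Proof.
move=> BBb; have [BBe BBI BBx] := BBb; split=> // B x BB_B O C Ox accC.
have [_ [B1 BB1 <-] B1O] := (BBx x).2 _ Ox.
have [B2 BB2 B2I] := BBI _ _ BB_B BB1.
exists (xsection B2 x); split.
- by exists B2 => //; split=> // p /B2I[].
- by apply/xsectionP; exact: BBe.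
- by move=> y /xsectionP/B2I[_ ?]; apply/B1O/xsectionP.
- by apply: accC; apply: (BBx x).1; exists B2.
Qed.

Section LeastCardinals.
Variable X : topologicalType.

(** The neighborhood assignments of X form an entourage base, so netbases exist. *)
Lemma chi_pstar_spec : is_least_cardinal (fun K => $|K| /\
    exists EE BB : set (set (X * X)), pstar_netbase EE BB /\ EE #<= [set: K])
  (chi_pstar X).
Proof.
apply: (@least_cardinalP _ (set (X * X))).
  move=> K1 K2; rewrite card_eq_le => /andP[K12 _] [[k] [EE [BB [net EEK]]]].
  split; first by have [f _] := card_leT_inj K12; exact: squash (f k).
  by exists EE, BB; split=> //; exact: card_le_trans EEK K12.
split; first exact: squash set0.
pose BB := [set E : set (X * X) | forall x, nbhs x (xsection E x)].
exists BB, BB; split; last exact: card_leT.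
apply: pstar_netbase_refl; split.
- by move=> E EB x; apply/xsectionP; exact: nbhs_singleton.
- move=> B1 B2 BB1 BB2; exists (B1 `&` B2) => // x.
  apply: filterS (filterI (BB1 x) (BB2 x)) => y [/xsectionP? /xsectionP?].
  exact/xsectionP.
- move=> x; split=> [_ [E EB <-]|O Ox]; first exact: EB.
  pose E := [set p : X * X | p.1 = x -> O p.2].
  exists (xsection E x); last by move=> y /xsectionP; exact.
  exists E => // y; have [->|yx] := pselect (y = x).
    by apply: filterS Ox => z Oz; apply/xsectionP.
  by apply: filterS filterT => z _; apply/xsectionP.
Qed.

Lemma chi_at_spec (x : X) : is_least_cardinal
  (fun K => exists N : set (set X), nbhd_base x N /\ N #= [set: K]) (chi_at x).
Proof.
apply: (@least_cardinalP _ {U : set X | U \in (nbhs x : set (set X))}).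
  move=> K1 K2 K12 [N [Nb NK]]; exists N; split=> //.
  exact: card_eq_trans NK K12.
exists (nbhs x); split; last exact: card_setT_sym.
by split=> // O Ox; exists O.
Qed.

Lemma chi_spec : is_least_cardinal
  (fun K => forall x : X, [set: chi_at x] #<= [set: K]) (chi X).
Proof.
apply: (@least_cardinalP _ {x : X & chi_at x}).
  move=> K1 K2; rewrite card_eq_le => /andP[K12 _] H x.
  exact: card_le_trans (H x) K12.
move=> x; apply: (@inj_card_leT _ {y : X & chi_at y} (existT _ x)) => c c'.
exact: existT_inj2.
Qed.

Lemma lindelof_number_spec : is_least_cardinal (fun K => forall VV : set (set X),
    (forall V, VV V -> open V) -> \bigcup_(V in VV) V = [set: X] ->
    exists WW : set (set X),
      [/\ WW `<=` VV, WW #<= [set: K] & \bigcup_(V in WW) V = [set: X]])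
  (lindelof_number X).
Proof.
apply: (@least_cardinalP _ (set X)).
  move=> K1 K2; rewrite card_eq_le => /andP[K12 _] cov VV VVo VVT.
  have [WW [WWV WWK WWT]] := cov VV VVo VVT.
  by exists WW; split=> //; exact: card_le_trans WWK K12.
by move=> VV _ VVT; exists VV; split=> //; exact: card_leT.
Qed.

Lemma least_covered_by_spec (h : set (set X) -> set X) :
  (forall VV, \bigcup_(V in VV) V `<=` h VV) ->
  is_least_cardinal (covered_by h) (least_cardinal (covered_by h)).
Proof.
move=> hext; apply: (@least_cardinalP _ (set X)).
  move=> K1 K2; rewrite card_eq_le => /andP[K12 _]; exact: covered_by_card_le.
move=> C VV _ _ CVV; exists VV; split=> //; first exact: card_leT.
exact: subset_trans CVV (hext VV).
Qed.

Lemma aLc_spec :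
  is_least_cardinal
    (covered_by (fun WW : set (set X) => \bigcup_(W in WW) closure W)) (aLc X).
Proof.
apply: least_covered_by_spec => VV x [V VVV Vx].
by exists V => //; exact: subset_closure.
Qed.

Lemma wLc_spec :
  is_least_cardinal
    (covered_by (fun WW : set (set X) => closure (\bigcup_(W in WW) W))) (wLc X).
Proof. by apply: least_covered_by_spec => VV; exact: subset_closure. Qed.

Lemma cellularity_spec : is_least_cardinal (fun K => forall VV : set (set X),
    (forall V, VV V -> open V) -> (forall V, VV V -> V !=set0) ->
    trivIset VV id -> VV #<= [set: K]) (cellularity X).
Proof.
apply: (@least_cardinalP _ (set X)); last by move=> VV *; exact: card_leT.
move=> K1 K2; rewrite card_eq_le => /andP[K12 _] cel VV VVo VVn0 VVd.
by apply: card_le_trans (cel VV _ _ _) K12.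
Qed.

(** A cover of C together with the complement of C covers X. *)
Lemma aLc_le_lindelof : [set: aLc X] #<= [set: lindelof_number X].
Proof.
apply: aLc_spec.2 => C VV Ccl VVo CVV.
have [||WW [WWV WWL WWT]] := lindelof_number_spec.1 (VV `|` [set ~` C]).
- by move=> V [/VVo//|->]; exact: closed_openC.
- apply/seteqP; split=> // x _; have [Cx|nCx] := pselect (C x).
    by have [V VVV Vx] := CVV x Cx; exists V => //; left.
  by exists (~` C) => //; right.
exists (WW `&` VV); split=> [V []//||x Cx].
  by apply: card_le_trans WWL; apply: subset_card_le => V [].
have [V WWV' Vx] : (\bigcup_(V in WW) V) x by rewrite WWT.
have [VVV|VC] := WWV _ WWV'; last by rewrite VC in Vx.
by exists V => //; exact: subset_closure.
Qed.

(** A maximal disjoint family G of nonempty open sets that refine the cover has a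
    union dense in the union of the cover; replacing each member of G by a member
    of the cover that contains it keeps the density and the cardinality. *)
Lemma wLc_le_cellularity : [set: wLc X] #<= [set: cellularity X].
Proof.
apply: wLc_spec.2 => C VV Ccl VVo CVV.
pose D := [set W : set X | [/\ open W, W !=set0 & exists2 V, VV V & W `<=` V]].
have [G [GD Gdisj Gmax]] := ex_maximal_disjoint_subcollection (@id (set X)) D.
have /choice[v vP] (W : set X) : exists V, G W -> VV V /\ W `<=` V.
  have [/GD[_ _ [V ? ?]]|nG] := pselect (G W); first by exists V.
  by exists setT.
exists (v @` G); split.
- by move=> _ [W /vP[? _] <-].
- apply: card_le_trans (card_image_le _ _) _.
  by apply: cellularity_spec.1 => // W /GD[].
move=> x /CVV[V VVV Vx] U Ux.
pose W := interior U `&` V.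
have DW : D W.
  split; last by exists V => // y [].
    by apply: openI; [exact: open_interior|exact: VVo].
  by exists x; split=> //; exact: Ux.
apply: contrapT => nU.
have WG W' : G W' -> ~ (W `&` W' !=set0).
  move=> GW' [y [[/interior_subset Uy _] W'y]]; apply: nU.
  by exists y; split=> //; exists (v W'); [exists W'|exact: (vP _ GW').2].
(* A neighborhood of x that misses the union would provide W, a further member. *)
apply: (Gmax (G `|` [set W])).
- split; first by move=> ?; left.
  move=> /(_ W (or_intror erefl)) GW; apply: (WG W GW).
  by have [_ Wn0 _] := DW; rewrite setIid.
- by move=> W' [/GD//|->].
- move=> A B [GA|->] [GB|->] //; first exact: Gdisj.
  + by rewrite setIC => /(WG A GA).
  + by move=> /(WG B GB).
Qed.

(** Bases at all points indexed by the same K give neighborhood assignments u k. The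
    finite intersections E s of the corresponding entourages form an entourage
    base with at most |K| members if K is infinite; if K is finite, the
    intersection of all of them is an entourage base by itself. *)
Lemma chi_pstar_le_chi : $|X| -> [set: chi_pstar X] #<= [set: chi X].
Proof.
move=> [x0]; apply: chi_pstar_spec.2; move: chi_spec.1; move: (chi X) => K chiK.
have /choice[u uP] (x : X) : exists u : {classic K} -> set X,
    (forall k, nbhs x (u k)) /\ forall O, nbhs x O -> exists k, u k `<=` O.
  have [N [[Nx Nbase] NK]] := (chi_at_spec x).1.
  have [u uN] : exists u : {classic K} -> set X, range u = N.
    apply: card_le_enum; first by have [U NU _] := Nbase _ filterT; exists U.
    move: NK; rewrite card_eq_le => /andP[NK _].
    exact: card_le_trans NK (chiK x).
  exists u; split=> [k|O /Nbase[U]]; first by apply: Nx; rewrite -uN; exists k.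
  by rewrite -uN => -[k _ <-]; exists k.
have [k0 _] := (uP x0).2 _ filterT.
pose E (s : seq {classic K}) :=
  [set p : X * X | forall k, k \in s -> u p.1 k p.2].
have Ediag s : is_entourage (E s).
  by move=> x k _; exact: nbhs_singleton ((uP x).1 k).
have Enbhs s x : nbhs x (xsection (E s) x).
  elim: s => [|k s IHs]; first by apply: filterS filterT => y _; exact/xsectionP.
  apply: filterS (filterI ((uP x).1 k) IHs) => y [uky /xsectionP Esy].
  by apply/xsectionP => k'; rewrite inE => /orP[/eqP->|/Esy].
have Esub s k x : k \in s -> xsection (E s) x `<=` u x k.
  by move=> ks y /xsectionP/(_ k ks).
split; first exact: squash (k0 : K).
have [/finite_seqP[s sE]|Kinf] := pselect (finite_set [set: {classic K}]).
  exists [set E s], [set E s]; split; last first.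
    apply: (@card_le_trans _ _ _ (range (fun _ : unit => E s))).
      by apply: subset_card_le => _ ->; exists tt.
    apply: card_le_trans (card_image_le _ _) _.
    by apply: (@inj_card_leT _ _ (fun _ => k0 : K)) => -[] [].
  apply: pstar_netbase_refl; split.
  - by move=> _ ->; exact: Ediag.
  - by move=> _ _ -> ->; exists (E s) => // p.
  - move=> x; split=> [_ [_ -> <-]|O /(uP x).2[k kO]]; first exact: Enbhs.
    exists (xsection (E s) x); first by exists (E s).
    apply: subset_trans kO; apply: Esub.
    by have : [set: {classic K}] k by []; rewrite sE.
exists (range E), (range E); split; last first.
  exact: card_le_trans (card_image_le _ _) (card_seq Kinf).
apply: pstar_netbase_refl; split.
- by move=> _ [s _ <-]; exact: Ediag.
- move=> _ _ [s _ <-] [t _ <-]; exists (E (s ++ t)); first by exists (s ++ t).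
  by move=> p Ep; split=> k ks; apply: Ep; rewrite mem_cat ks ?orbT.
- move=> x; split=> [_ [_ [s _ <-] <-]|O /(uP x).2[k kO]]; first exact: Enbhs.
  exists (xsection (E [:: k]) x); first by exists (E [:: k]) => //; exists [:: k].
  by apply: subset_trans kO; apply: Esub; rewrite mem_head.
Qed.

(** In the empty space chi is 0 but chi_pstar is 1, so there the second factor has
    to be 0. *)
Lemma card_prod_chi_pstar_le (U : Type) :
  (~ $|X| -> [set: U] #<= [set: False]) ->
  [set: chi_pstar X * U] #<= [set: chi X * U].
Proof.
move=> UX; have [X0|nX] := pselect $|X|.
  exact: card_prod_le (chi_pstar_le_chi X0) (card_lexx _).
have /card_leT_inj[f _] := UX nX.
apply: (@inj_card_leT _ _ (fun p => False_rect _ (f p.2))) => -[a u].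
by case: (f u).
Qed.

Lemma lindelof_number_empty : ~ $|X| -> [set: lindelof_number X] #<= [set: False].
Proof.
move=> nX; apply: lindelof_number_spec.2 => VV _ _.
exists set0; split; [exact: sub0set|exact: card_ge0|].
by apply/seteqP; split=> // x; case: nX; exact: squash x.
Qed.

Lemma cellularity_empty : ~ $|X| -> [set: cellularity X] #<= [set: False].
Proof.
move=> nX; apply: cellularity_spec.2 => VV _ VVn0 _.
have -> : VV = set0; last exact: card_ge0.
by apply/seteqP; split=> // V /VVn0[x _]; case: nX; exact: squash x.
Qed.

End LeastCardinals.

Theorem theorem8p5 (X : topologicalType) (hausX : hausdorff_space X) :
  [/\ [set: X] #<= [set: chi_pstar X * aLc X -> bool],
      [set: chi_pstar X * aLc X -> bool]
        #<= [set: chi_pstar X * lindelof_number X -> bool]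
    & [set: chi_pstar X * lindelof_number X -> bool]
        #<= [set: chi X * lindelof_number X -> bool]] /\
  (regular_space X ->
  [/\ [set: X] #<= [set: chi_pstar X * wLc X -> bool],
      [set: chi_pstar X * wLc X -> bool]
        #<= [set: chi_pstar X * cellularity X -> bool]
    & [set: chi_pstar X * cellularity X -> bool]
        #<= [set: chi X * cellularity X -> bool]]).
Proof.
have [chi0 [EE [BB [netEB EEchi]]]] := (chi_pstar_spec X).1.
split=> [|regX]; split.
- exact: card_le_pow_cover netEB EEchi chi0 (aLc_spec X).1
    (point_separating_bigcup_closure hausX).
- apply/card_pow_le/card_prod_le; [exact: card_lexx|exact: aLc_le_lindelof].
- exact/card_pow_le/card_prod_chi_pstar_le/lindelof_number_empty.
- exact: card_le_pow_cover netEB EEchi chi0 (wLc_spec X).1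
    (point_separating_closure_bigcup regX).
- apply/card_pow_le/card_prod_le; [exact: card_lexx|exact: wLc_le_cellularity].
- exact/card_pow_le/card_prod_chi_pstar_le/cellularity_empty.
Qed.
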